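(* Let $\mathcal C$ be a semisimple strict rigid C*-tensor category with at most countably many isomorphism classes of simple objects, and let $\Lambda\subseteq[Obj(\mathcal C)]$ be a weight set containing the class $0$ of the tensor unit (with representative $Y_0=X_0=id$). Then the fusion algebra $\mathbb C[\mathrm{Irr}(\mathcal C)]$ is $*$-isomorphic to $\mathcal A\Lambda_{0,0}$ via the linear map sending $[X_k]$ to $1_{X_k}\in Mor(X_k\otimes id,id\otimes X_k)=\mathcal A\Lambda^k_{0,0}$, $k\in \mathrm{Irr}(\mathcal C)$.
   Context: Categories. $\mathcal C$ is a C*-category with finite-dimensional morphism spaces $Mor(X,Y)$, finite direct sums and subobjects, a strict tensor functor $\otimes$ compatible with $*$, simple tensor unit $id$, duals, and at most countably many isomorphism classes of simple objects. $\mathrm{Irr}(\mathcal C)$ is the set of isomorphism classes of simple objects, $X_k$ a chosen representative of $k\in \mathrm{Irr}(\mathcal C)$, $0$ the class of the unit, $X_0=id$. $[Obj(\mathcal C)]$ is the set of isomorphism classes of objects. $R_k\in Mor(id,\overline X_k\otimes X_k)$, $\overline R_k\in Mor(id,X_k\otimes\overline X_k)$ are standard solutions of the conjugate equations, with $\overline X_k$ identified with $X_{\overline k}$. The fusion algebra $\mathbb C[\mathrm{Irr}(\mathcal C)]$ has basis the classes $[X]$ of simple objects, product $[X][Y]=\sum_Z N^Z_{XY}[Z]$, where $N^Z_{XY}$ is the multiplicity of $Z$ in $X\otimes Y$, and conjugate-linear involution $[X]^*=[\overline X]$. Annular algebra. For a weight set $\Lambda\subseteq[Obj(\mathcal C)]$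 with chosen representatives $Y_i\in i$ ($i\in\Lambda$), $\mathcal A\Lambda=\bigoplus_{i,j\in\Lambda,\,k\in \mathrm{Irr}(\mathcal C)}\mathcal A\Lambda^k_{i,j}$, $\mathcal A\Lambda^k_{i,j}=Mor(X_k\otimes Y_i,Y_j\otimes X_k)$, $\mathcal A\Lambda_{i,j}=\bigoplus_k\mathcal A\Lambda^k_{i,j}$. It is a $*$-algebra with product $$(x\cdot y)^k_{i,j}=\sum_{s\in\Lambda,\ m,l\in \mathrm{Irr}(\mathcal C)}\ \sum_{V\in onb(X_k,X_m\otimes X_l)}(1_j\otimes V^* )(x^m_{s,j}\otimes 1_l)(1_m\otimes y^l_{i,s})(V\otimes 1_i)$$ and involution $$(x^\#)^k_{i,j}=(\overline R_k^*\otimes 1_j\otimes 1_k)(1_k\otimes (x^{\overline k}_{j,i})^*\otimes 1_k)(1_k\otimes 1_i\otimes R_k),$$ where $onb(X_k,\beta)$ is an orthonormal basis of $Mor(X_k,\beta)$ for the inner product $\eta^*\xi=\langle\xi,\eta\rangle 1_{X_k}$. *)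

(* Defs.v *)
From HB Require Import structures.
From mathcomp Require Import all_boot all_order all_algebra.
From mathcomp Require Import complex.
From mathcomp Require Import boolp classical_sets functions cardinality fsbigop.
From mathcomp Require Import reals.

Set Implicit Arguments.
Unset Strict Implicit.
Unset Printing Implicit Defensive.

Import Order.TTheory GRing.Theory Num.Theory.

Local Open Scope classical_set_scope.
Local Open Scope ring_scope.
Local Open Scope complex_scope.

Declare Scope cat_scope.
Delimit Scope cat_scope with cat.
Local Open Scope cat_scope.

Reserved Notation "g \oc f" (at level 40, left associativity).
Reserved Notation "X \ox Y" (at level 35, right associativity).
Reserved Notation "f \tx g" (at level 35, right associativity).

(* C*-categories with finite-dimensional morphism spaces.  The morphism
   spaces are vector spaces over R[i] of finite dimension, so completeness of
   the norm is automatic.  [dagM_pos] says that f^* f is a positive element of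
   the C*-algebra End(X). *)
Record cstarCat (R : realType) := CStarCat {
  obj :> Type;
  Mor : obj -> obj -> vectType R[i];
  idm : forall X, Mor X X;
  comp : forall X Y Z, Mor Y Z -> Mor X Y -> Mor X Z;
  dag : forall X Y, Mor X Y -> Mor Y X;
  mnorm : forall X Y, Mor X Y -> R;
  compA : forall X Y Z W (h : Mor Z W) (g : Mor Y Z) (f : Mor X Y),
    comp h (comp g f) = comp (comp h g) f;
  comp1m : forall X Y (f : Mor X Y), comp (idm Y) f = f;
  compm1 : forall X Y (f : Mor X Y), comp f (idm X) = f;
  comp_linl : forall X Y Z (f : Mor X Y) (a : R[i]) (g g' : Mor Y Z),
    comp (a *: g + g') f = a *: comp g f + comp g' f;
  comp_linr : forall X Y Z (g : Mor Y Z) (a : R[i]) (f f' : Mor X Y),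
    comp g (a *: f + f') = a *: comp g f + comp g f';
  dag_antilin : forall X Y (a : R[i]) (f f' : Mor X Y),
    dag (a *: f + f') = a^* *: dag f + dag f';
  dagK : forall X Y (f : Mor X Y), dag (dag f) = f;
  dag_id : forall X, dag (idm X) = idm X;
  dag_comp : forall X Y Z (g : Mor Y Z) (f : Mor X Y),
    dag (comp g f) = comp (dag f) (dag g);
  mnorm_eq0 : forall X Y (f : Mor X Y), mnorm f = 0 -> f = 0;
  mnormD : forall X Y (f g : Mor X Y), mnorm (f + g) <= mnorm f + mnorm g;
  mnormZ : forall X Y (a : R[i]) (f : Mor X Y),
    mnorm (a *: f) = complex.Re `|a| * mnorm f;
  mnormM : forall X Y Z (g : Mor Y Z) (f : Mor X Y),
    mnorm (comp g f) <= mnorm g * mnorm f;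
  mnorm_dagM : forall X Y (f : Mor X Y),
    mnorm (comp (dag f) f) = mnorm f ^+ 2;
  dagM_pos : forall X Y (f : Mor X Y),
    exists g : Mor X X, comp (dag f) f = comp (dag g) g
}.

Arguments Mor {R C} X Y : rename.
Arguments idm {R C} X : rename.
Arguments comp {R C X Y Z} g f : rename.
Arguments dag {R C X Y} f : rename.
Arguments mnorm {R C X Y} f : rename.

Notation "g \oc f" := (comp g f) : cat_scope.

Section CStarCategory.
Variables (R : realType) (C : cstarCat R).
Implicit Types X Y Z W S : C.

(* The identity morphism along an equality of objects.  Strictness of the
   tensor product is Leibniz equality of objects, and [eqm] is the identity
   morphism which that equality leaves implicit on paper. *)
Definition eqm X Y (e : X = Y) : Mor X Y :=
  match e in _ = Z return Mor X Z with erefl => idm X end.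

Definition iso X Y : Prop :=
  exists (f : Mor X Y) (g : Mor Y X), g \oc f = idm X /\ f \oc g = idm Y.

Definition iso_class X : set C := [set Y | iso X Y].

Definition Obj_classes : set (set C) := [set A | exists X, A = iso_class X].

Definition simple X : Prop :=
  idm X != 0 /\ forall f : Mor X X, exists c : R[i], f = c *: idm X.

Definition Irr : set (set C) :=
  [set A | exists2 X, simple X & A = iso_class X].

Definition has_direct_sums : Prop :=
  forall X Y, exists W (u : Mor X W) (v : Mor Y W),
    [/\ dag u \oc u = idm X, dag v \oc v = idm Y
      & u \oc dag u + v \oc dag v = idm W].

Definition has_subobjects : Prop :=
  forall X (p : Mor X X), p \oc p = p -> dag p = p ->
    exists Y (v : Mor Y X), dag v \oc v = idm Y /\ v \oc dag v = p.

(* The isometries v exhibit W as the orthogonal direct sum of the S a. *)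
Definition direct_sum n (S : 'I_n -> C) W (v : forall a, Mor (S a) W) : Prop :=
  [/\ forall a, dag (v a) \oc v a = idm (S a),
      forall a b, a != b -> dag (v a) \oc v b = 0
    & \sum_(a < n) v a \oc dag (v a) = idm W].

Definition semisimple : Prop :=
  forall W, exists n (S : 'I_n -> C) (v : forall a, Mor (S a) W),
    direct_sum v /\ forall a, simple (S a).

(* m is the number of summands isomorphic to Z in some decomposition of W into
   simple objects; see [is_multiplicity_dim] for the independence of the
   decomposition. *)
Definition is_multiplicity Z W (m : nat) : Prop :=
  exists n (S : 'I_n -> C) (v : forall a, Mor (S a) W),
    [/\ direct_sum v, forall a, simple (S a)
      & #|[set a | `[< iso Z (S a) >]]%SET| = m].

Definition multiplicity Z W : nat := xget 0%N (is_multiplicity Z W).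

(* The inner product on Mor(X, W), X simple, is given by
   eta^* xi = <xi, eta> 1_X. *)
Definition onb X W (s : seq (Mor X W)) : Prop :=
  basis_of fullv s /\
  forall a b, (a < size s)%N -> (b < size s)%N ->
    dag s`_a \oc s`_b = (a == b)%:R *: idm X.

Lemma comp0m X Y Z (f : Mor X Y) : (0 : Mor Y Z) \oc f = 0.
Proof.
have := comp_linl f 1 (0 : Mor Y Z) 0.
by rewrite !scale1r addr0 -{1}[0 \oc f]addr0 => /addrI.
Qed.

Lemma compm0 X Y Z (g : Mor Y Z) : g \oc (0 : Mor X Y) = 0.
Proof.
have := comp_linr g 1 (0 : Mor X Y) 0.
by rewrite !scale1r addr0 -{1}[g \oc 0]addr0 => /addrI.
Qed.

Lemma compDl X Y Z (f : Mor X Y) (g g' : Mor Y Z) :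
  (g + g') \oc f = g \oc f + g' \oc f.
Proof. by have := comp_linl f 1 g g'; rewrite !scale1r. Qed.

Lemma compDr X Y Z (g : Mor Y Z) (f f' : Mor X Y) :
  g \oc (f + f') = g \oc f + g \oc f'.
Proof. by have := comp_linr g 1 f f'; rewrite !scale1r. Qed.

Lemma compZl X Y Z (f : Mor X Y) a (g : Mor Y Z) : (a *: g) \oc f = a *: (g \oc f).
Proof. by have := comp_linl f a g 0; rewrite !addr0 comp0m addr0. Qed.

Lemma compZr X Y Z (g : Mor Y Z) a (f : Mor X Y) : g \oc (a *: f) = a *: (g \oc f).
Proof. by have := comp_linr g a f 0; rewrite !addr0 compm0 addr0. Qed.

Lemma comp_suml X Y Z I (r : seq I) (P : pred I) (F : I -> Mor Y Z) (f : Mor X Y) :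
  (\sum_(a <- r | P a) F a) \oc f = \sum_(a <- r | P a) F a \oc f.
Proof.
by apply: (big_morph (fun g : Mor Y Z => g \oc f)); [move=> ? ?; exact: compDl | exact: comp0m].
Qed.

Lemma comp_sumr X Y Z I (r : seq I) (P : pred I) (F : I -> Mor X Y) (g : Mor Y Z) :
  g \oc (\sum_(a <- r | P a) F a) = \sum_(a <- r | P a) g \oc F a.
Proof.
by apply: (big_morph (fun f : Mor X Y => g \oc f)); [move=> ? ?; exact: compDr | exact: compm0].
Qed.

Lemma dag0 X Y : dag (0 : Mor X Y) = 0.
Proof.
have := dag_antilin 1 (0 : Mor X Y) 0.
by rewrite scale1r addr0 rmorph1 scale1r -{1}[dag 0]addr0 => /addrI.
Qed.

Lemma dagM_eq0 X Y (f : Mor X Y) : dag f \oc f = 0 -> f = 0.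
Proof.
move=> f0; apply: mnorm_eq0; apply/eqP; rewrite -sqrf_eq0 -mnorm_dagM f0.
by have := mnormZ 0 (0 : Mor X X); rewrite scale0r normr0 /= mul0r => ->.
Qed.

Lemma iso_sym X Y : iso X Y -> iso Y X.
Proof. by move=> [f [g [gf fg]]]; exists g, f. Qed.

Lemma iso_trans X Y Z : iso X Y -> iso Y Z -> iso X Z.
Proof.
move=> [f [g [gf fg]]] [f' [g' [gf' fg']]]; exists (f' \oc f), (g \oc g'); split.
  by rewrite compA -(compA g) gf' compm1.
by rewrite compA -(compA f') fg compm1.
Qed.

Lemma iso_class_eq X Y : iso X Y -> iso_class X = iso_class Y.
Proof.
move=> XY; apply/seteqP; split=> Z /=; first by apply: iso_trans (iso_sym XY).
by apply: iso_trans.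
Qed.

Lemma simple_iso X Y : simple X -> iso X Y -> simple Y.
Proof.
move=> [X0 sX] [f [g [gf fg]]]; split.
  apply: contra_neq X0 => Y0.
  by rewrite -gf -[f]comp1m Y0 comp0m compm0.
move=> h; have [c hc] := sX (g \oc h \oc f); exists c.
have : f \oc (g \oc h \oc f) \oc g = h.
  by rewrite !compA fg comp1m -compA fg compm1.
by rewrite hc => <-; rewrite compZr compm1 compZl fg.
Qed.

Lemma schur X Y (f : Mor X Y) : simple X -> simple Y -> f != 0 -> iso X Y.
Proof.
move=> [X0 sX] [Y0 sY] f0.
have [c fc] := sX (dag f \oc f); have [d fd] := sY (f \oc dag f).
have c0 : c != 0.
  apply: contra_neq f0 => c0; apply: dagM_eq0.
  by rewrite fc c0 scale0r.
have d0 : d != 0.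
  apply: contra_neq f0 => d0; rewrite -[f]dagK.
  rewrite (dagM_eq0 (f := dag f)) ?dag0// dagK.
  by rewrite fd d0 scale0r.
have cd : c = d.
  have : c *: f = d *: f.
    by rewrite -{1}[f]compm1 -compZr -fc compA fd compZl comp1m.
  move/eqP; rewrite -subr_eq0 -scalerBl scaler_eq0 (negbTE f0) orbF subr_eq0.
  by move/eqP.
exists f, (c^-1 *: dag f); split.
  by rewrite compZl fc scalerA mulVf // scale1r.
by rewrite compZr fd cd scalerA mulVf // scale1r.
Qed.

(* A pairwise non-isomorphic family of simple objects has only finitely many
   members with a nonzero morphism to a given object: the projections onto
   these are linearly independent in the finite-dimensional algebra End(W). *)
Lemma simple_family_uniq_size n (S : 'I_n -> C) W (v : forall a, Mor (S a) W) :
    (forall a, simple (S a)) -> (forall a, v a != 0) ->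
    (forall a b, iso (S a) (S b) -> a = b) ->
  (n <= \dim (fullv : {vspace (Mor W W)}))%N.
Proof.
move=> sS v0 Sinj.
pose p := [tuple v a \oc dag (v a) | a < n].
have : free p.
  apply/freeP => c cp0 b.
  have : (\sum_a c a *: p`_a) \oc v b = 0 by rewrite cp0 comp0m.
  rewrite comp_suml (bigD1 b)//= big1 ?addr0; last first.
    move=> a ab; rewrite nth_mktuple compZl -compA.
    have [->|vn0] := eqVneq (dag (v a) \oc v b) 0; first by rewrite compm0 scaler0.
    by have /Sinj ba := schur (sS b) (sS a) vn0; rewrite ba eqxx in ab.
  rewrite nth_mktuple compZl -compA.
  have [d vd] := (sS b).2 (dag (v b) \oc v b).
  rewrite vd compZr compm1 scalerA => /eqP; rewrite scaler_eq0 (negbTE (v0 b)) orbF.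
  rewrite mulf_eq0 => /orP[/eqP//|/eqP d0].
  have /eqP := v0 b; case; apply: dagM_eq0.
  by rewrite vd d0 scale0r.
move=> fp; have := dimvS (subvf <<p>>%VS); rewrite (eqnP fp) size_tuple.
by [].
Qed.

Lemma is_multiplicity_mor Z W m :
  is_multiplicity Z W m -> m != 0%N -> simple Z -> exists f : Mor Z W, f != 0.
Proof.
move=> [n [S [v [[v1 _ _] sS <-]]]]; rewrite -lt0n => /card_gt0P[a].
rewrite inE => /asboolP[f [g [gf _]]] [Z0 _].
exists (v a \oc f); apply: contra_neq Z0 => vf0.
by rewrite -gf -[f]comp1m -v1 -compA vf0 !compm0.
Qed.

Lemma is_multiplicity_dim Z W m : simple Z -> is_multiplicity Z W m ->
  m = \dim (fullv : {vspace (Mor Z W)}).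
Proof.
move=> sZ [n [S [v [[v1 v_orth v_sum] sS <-]]]].
set A := [set a | _]%SET.
have isoZ a : {fg : Mor Z (S a) * Mor (S a) Z |
    iso Z (S a) -> fg.2 \oc fg.1 = idm Z /\ fg.1 \oc fg.2 = idm (S a)}.
  apply: cid; have [[f [g fg]]|no] := pselect (iso Z (S a)).
    by exists (f, g).
  by exists (0, 0) => /no.
pose f a := (sval (isoZ a)).1; pose g a := (sval (isoZ a)).2.
have fgP a : a \in A -> g a \oc f a = idm Z /\ f a \oc g a = idm (S a).
  by rewrite inE => /asboolP; exact: (svalP (isoZ a)).
pose B := [tuple v (enum_val (a : 'I_#|A|)) \oc f (enum_val a) | a < #|A|].
suff /size_basis <- : basis_of fullv B by rewrite ?size_tuple.
have Bi (a : 'I_#|A|) : B`_a = v (enum_val a) \oc f (enum_val a).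
  by rewrite nth_mktuple.
apply/andP; split; last first.
  apply/freeP => c cB b.
  have : (g (enum_val b) \oc dag (v (enum_val b))) \oc (\sum_a c a *: B`_a) = 0.
    by rewrite cB compm0.
  rewrite comp_sumr (bigD1 b)//= big1 ?addr0; last first.
    move=> a ab; rewrite Bi compZr compA -(compA _ (dag _)) v_orth.
      by rewrite compm0 comp0m scaler0.
    by apply: contra_neq ab => /enum_val_inj.
  rewrite Bi compZr compA -(compA _ (dag _)) v1 compm1.
  have [-> _] := fgP _ (enum_valP b).
  by move/eqP; rewrite scaler_eq0 (negbTE sZ.1) orbF => /eqP.
rewrite eqEsubv subvf; apply/subvP => h _.
rewrite -[h]comp1m -v_sum comp_suml; apply: memv_suml => a _.
rewrite -compA; set h' := dag (v a) \oc h.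
have [->|h'0] := eqVneq h' 0; first by rewrite compm0 mem0v.
have aA : a \in A by rewrite inE; apply/asboolP/(schur sZ (sS a) h'0).
have [_ fg] := fgP _ aA.
have [c hc] := sZ.2 (g a \oc h').
rewrite -[h']comp1m -fg -compA hc compZr compm1 compZr memvZ//.
have -> : v a \oc f a = B`_(enum_rank_in aA a) by rewrite Bi enum_rankK_in.
by apply: memv_span; apply: mem_nth; rewrite size_tuple.
Qed.

End CStarCategory.

Arguments Obj_classes {R} C.
Arguments Irr {R} C.

(* Algebraic direct sum: finitely supported families, pointwise operations. *)
Record dirsum (K : pzRingType) (I : Type) (V : I -> lmodType K) := DirSum {
  dsval :> forall t, V t;
  ds_finite : finite_set [set t | dsval t != 0]
}.

Section DirectSum.
Variables (K : pzRingType) (I : choiceType) (V : I -> lmodType K).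
Implicit Types x y : dirsum V.

Lemma dirsum_ext x y : (forall t, x t = y t) -> x = y.
Proof.
case: x y => [x fx] [y fy] /= xy.
have {}xy : x = y by apply: functional_extensionality_dep.
by subst y; congr DirSum; exact: Prop_irrelevance.
Qed.

HB.instance Definition _ := gen_eqMixin (dirsum V).
HB.instance Definition _ := gen_choiceMixin (dirsum V).

Lemma ds_zero_subproof : finite_set [set t : I | (0 : V t) != 0].
Proof. by apply: (sub_finite_set _ (finite_set0 I)) => t /=; rewrite eqxx. Qed.

Lemma ds_opp_subproof x : finite_set [set t | - x t != 0].
Proof. by apply: (sub_finite_set _ (ds_finite x)) => t /=; rewrite oppr_eq0. Qed.

Lemma ds_add_subproof x y : finite_set [set t | x t + y t != 0].
Proof.
apply: (@sub_finite_set _ _ ([set t | x t != 0] `|` [set t | y t != 0])).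
  move=> t /= xy; have [x0|] := eqVneq (x t) 0; last by left.
  by right; rewrite x0 add0r in xy.
by rewrite finite_setU; split; exact: ds_finite.
Qed.

Lemma ds_scale_subproof (a : K) x : finite_set [set t | a *: x t != 0].
Proof.
apply: (sub_finite_set _ (ds_finite x)) => t /=.
by apply: contra_neq => ->; rewrite scaler0.
Qed.

Definition ds_zero : dirsum V := DirSum ds_zero_subproof.
Definition ds_opp x : dirsum V := DirSum (ds_opp_subproof x).
Definition ds_add x y : dirsum V := DirSum (ds_add_subproof x y).
Definition ds_scale (a : K) x : dirsum V := DirSum (ds_scale_subproof a x).

Lemma ds_addA : associative ds_add.
Proof. by move=> x y z; apply: dirsum_ext => t /=; rewrite addrA. Qed.
Lemma ds_addC : commutative ds_add.
Proof. by move=> x y; apply: dirsum_ext => t /=; rewrite addrC. Qed.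
Lemma ds_add0 : left_id ds_zero ds_add.
Proof. by move=> x; apply: dirsum_ext => t /=; rewrite add0r. Qed.
Lemma ds_addN : left_inverse ds_zero ds_opp ds_add.
Proof. by move=> x; apply: dirsum_ext => t /=; rewrite addNr. Qed.

HB.instance Definition _ :=
  GRing.isZmodule.Build (dirsum V) ds_addA ds_addC ds_add0 ds_addN.

Lemma ds_scaleA (a b : K) x : ds_scale a (ds_scale b x) = ds_scale (a * b) x.
Proof. by apply: dirsum_ext => t /=; rewrite scalerA. Qed.
Lemma ds_scale1 : left_id 1 ds_scale.
Proof. by move=> x; apply: dirsum_ext => t /=; rewrite scale1r. Qed.
Lemma ds_scaleDr : right_distributive ds_scale +%R.
Proof. by move=> a x y; apply: dirsum_ext => t /=; rewrite scalerDr. Qed.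
Lemma ds_scaleDl x : {morph ds_scale^~ x : a b / a + b}.
Proof. by move=> a b; apply: dirsum_ext => t /=; rewrite scalerDl. Qed.

HB.instance Definition _ := GRing.Zmodule_isLmodule.Build K (dirsum V)
  ds_scaleA ds_scale1 ds_scaleDr ds_scaleDl.

(* The inclusion of the summand of index t. *)
Definition ds_in_fun (t : I) (u : V t) (t' : I) : V t' :=
  if @eqP I t t' is ReflectT e then
    match e in _ = t1 return V t1 with erefl => u end
  else 0.

Lemma ds_in_subproof t (u : V t) : finite_set [set t' | ds_in_fun u t' != 0].
Proof.
apply: (sub_finite_set _ (finite_set1 t)) => t' /=.
by rewrite /ds_in_fun; case: eqP => [e _|]; rewrite ?eqxx.
Qed.

Definition ds_in t (u : V t) : dirsum V := DirSum (ds_in_subproof u).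

End DirectSum.

Arguments ds_in {K I V} t u.

Record strictTensorCat (R : realType) := StrictTensorCat {
  tcat :> cstarCat R;
  unit_ob : tcat;
  tens : tcat -> tcat -> tcat;
  tensm : forall X X' Y Y' : tcat,
    Mor X X' -> Mor Y Y' -> Mor (tens X Y) (tens X' Y');
  tensm_linl : forall (X X' Y Y' : tcat) (a : R[i]) (f f' : Mor X X') (g : Mor Y Y'),
    tensm (a *: f + f') g = a *: tensm f g + tensm f' g;
  tensm_linr : forall (X X' Y Y' : tcat) (f : Mor X X') (a : R[i]) (g g' : Mor Y Y'),
    tensm f (a *: g + g') = a *: tensm f g + tensm f g';
  tensm_id : forall X Y : tcat, tensm (idm X) (idm Y) = idm (tens X Y);
  tensm_comp : forall (X X' X'' Y Y' Y'' : tcat) (f' : Mor X' X'') (f : Mor X X')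
      (g' : Mor Y' Y'') (g : Mor Y Y'),
    tensm (f' \oc f) (g' \oc g) = tensm f' g' \oc tensm f g;
  tensm_dag : forall (X X' Y Y' : tcat) (f : Mor X X') (g : Mor Y Y'),
    dag (tensm f g) = tensm (dag f) (dag g);
  tensA : forall X Y Z : tcat, tens X (tens Y Z) = tens (tens X Y) Z;
  tens1o : forall X : tcat, tens unit_ob X = X;
  tenso1 : forall X : tcat, tens X unit_ob = X;
  tensmA : forall (X X' Y Y' Z Z' : tcat)
      (f : Mor X X') (g : Mor Y Y') (h : Mor Z Z'),
    eqm (tensA X' Y' Z') \oc tensm f (tensm g h) =
    tensm (tensm f g) h \oc eqm (tensA X Y Z);
  tens1m : forall (X X' : tcat) (f : Mor X X'),
    eqm (tens1o X') \oc tensm (idm unit_ob) f = f \oc eqm (tens1o X);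
  tensm1 : forall (X X' : tcat) (f : Mor X X'),
    eqm (tenso1 X') \oc tensm f (idm unit_ob) = f \oc eqm (tenso1 X);
  simple_unit : simple unit_ob
}.

Arguments unit_ob {R} s.
Arguments tens {R s} X Y.
Arguments tensm {R s X X' Y Y'} f g.
Arguments tensA {R s} X Y Z.
Arguments tens1o {R s} X.
Arguments tenso1 {R s} X.

Notation "X \ox Y" := (tens X Y) : cat_scope.
Notation "f \tx g" := (tensm f g) : cat_scope.

Section TensorCategory.
Variables (R : realType) (C : strictTensorCat R).
Implicit Types X Y Z W : C.
Local Notation "1_" := (unit_ob C).

Lemma eqm_comp X Y Z (e : X = Y) (e' : Y = Z) :
  eqm e' \oc eqm e = eqm (etrans e e').
Proof. by subst Z Y; rewrite comp1m. Qed.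

Lemma eqm_irr X Y (e e' : X = Y) : eqm e = eqm e'.
Proof. by congr eqm; exact: Prop_irrelevance. Qed.

Lemma eqm_id X (e : X = X) : eqm e = idm X.
Proof. exact: (eqm_irr e erefl). Qed.

Lemma eqm_dag X Y (e : X = Y) : dag (eqm e) = eqm (esym e).
Proof. by subst Y; rewrite dag_id. Qed.

Lemma eqmK X Y Z (e : X = Y) (f : Mor Z X) : eqm (esym e) \oc (eqm e \oc f) = f.
Proof. by subst Y; rewrite !comp1m. Qed.

Lemma eqmVK X Y Z (e : Y = X) (f : Mor Z X) : eqm e \oc (eqm (esym e) \oc f) = f.
Proof. by subst Y; rewrite !comp1m. Qed.

Lemma eqm_move X Y Z (e : Y = X) (e' : X = Z) (f : Mor Z Y) :
  eqm e \oc (f \oc eqm e') = idm X -> f = eqm (etrans (esym e') (esym e)).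
Proof. by case: _ / e' f; subst X => f /=; rewrite comp1m compm1. Qed.

Lemma eqm_eq0 X Y Z (e : Y = X) (f : Mor Z Y) : eqm e \oc f = 0 -> f = 0.
Proof. by subst X; rewrite comp1m. Qed.

Lemma tensm_eqm X X' Y Y' (e : X = X') (e' : Y = Y') :
  eqm e \tx eqm e' = eqm (f_equal2 tens e e').
Proof. by case: _ / e; case: _ / e'; rewrite /= tensm_id eqm_id. Qed.

Lemma tens_unitC X Y : Y = 1_ -> X \ox Y = Y \ox X.
Proof. by move=> ->; rewrite tens1o tenso1. Qed.

Lemma tens0m X X' Y Y' (g : Mor Y Y') : (0 : Mor X X') \tx g = 0.
Proof.
have := tensm_linl 1 (0 : Mor X X') 0 g.
by rewrite !scale1r addr0 -{1}[0 \tx g]addr0 => /addrI.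
Qed.

Lemma tensm0 X X' Y Y' (f : Mor X X') : f \tx (0 : Mor Y Y') = 0.
Proof.
have := tensm_linr f 1 (0 : Mor Y Y') 0.
by rewrite !scale1r addr0 -{1}[f \tx 0]addr0 => /addrI.
Qed.

Lemma tensmA_r X X' Y Y' Z Z' (f : Mor X X') (g : Mor Y Y') (h : Mor Z Z') :
  f \tx (g \tx h) = eqm (esym (tensA X' Y' Z')) \oc ((f \tx g) \tx h) \oc eqm (tensA X Y Z).
Proof. by rewrite -compA -tensmA eqmK. Qed.

Lemma tensmA_l X X' Y Y' Z Z' (f : Mor X X') (g : Mor Y Y') (h : Mor Z Z') :
  (f \tx g) \tx h = eqm (tensA X' Y' Z') \oc (f \tx (g \tx h)) \oc eqm (esym (tensA X Y Z)).
Proof. by rewrite tensmA -compA eqm_comp eqm_id compm1. Qed.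

Definition conjugate_eqs X Xb (r : Mor 1_ (Xb \ox X)) (rb : Mor 1_ (X \ox Xb)) :=
  eqm (tens1o X) \oc (dag rb \tx idm X) \oc eqm (tensA X Xb X) \oc
    (idm X \tx r) \oc eqm (esym (tenso1 X)) = idm X /\
  eqm (tens1o Xb) \oc (dag r \tx idm Xb) \oc eqm (tensA Xb X Xb) \oc
    (idm Xb \tx rb) \oc eqm (esym (tenso1 Xb)) = idm Xb.

(* A solution for a simple object is standard when ||R|| = ||Rbar||. *)
Definition standard_solution_simple X Xb
    (r : Mor 1_ (Xb \ox X)) (rb : Mor 1_ (X \ox Xb)) : Prop :=
  conjugate_eqs r rb /\ mnorm r = mnorm rb.

Definition rigid : Prop :=
  forall X, exists Xb (r : Mor 1_ (Xb \ox X)) (rb : Mor 1_ (X \ox Xb)),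
    conjugate_eqs r rb.

(* Two objects with the same conjugate are related by this morphism, which is
   invertible; nonvanishing is enough for simple objects. *)
Lemma conjugate_mor_neq0 X Y Xb (r : Mor 1_ (Xb \ox X)) (rb : Mor 1_ (X \ox Xb))
    (r' : Mor 1_ (Xb \ox Y)) (rb' : Mor 1_ (Y \ox Xb)) :
    conjugate_eqs r rb -> conjugate_eqs r' rb' -> idm Y != 0 ->
  (dag rb \tx idm Y) \oc eqm (tensA X Xb Y) \oc (idm X \tx r') != 0.
Proof.
move=> [_ r2] [r1' _]; apply: contra_neq; set M := _ \oc (idm X \tx r') => M0.
suff r'0 : r' = 0.
  by rewrite -r1' r'0 tensm0 compm0 comp0m.
have {r2} r2 : (idm Xb \tx dag rb) \oc (eqm (esym (tensA Xb X Xb)) \oc (r \tx idm Xb))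
    = eqm (etrans (tens1o Xb) (esym (tenso1 Xb))).
  have := congr1 (@dag _ _ _ _) r2.
  rewrite !dag_comp !tensm_dag !dag_id !dagK !eqm_dag.
  rewrite (compA (eqm _) (r \tx _)) (compA (_ \tx _) (_ \oc _)) => /eqm_move ->.
  exact: eqm_irr.
have splitl (A U V W : C) (g : Mor V W) (f : Mor U V) :
    idm A \tx (g \oc f) = (idm A \tx g) \oc (idm A \tx f).
  by rewrite -tensm_comp comp1m.
have splitr (A U V W : C) (g : Mor V W) (f : Mor U V) :
    (g \oc f) \tx idm A = (g \tx idm A) \oc (f \tx idm A).
  by rewrite -tensm_comp comp1m.
have E : (idm Xb \tx (idm X \tx r')) \oc (eqm (esym (tensA Xb X 1_)) \oc (r \tx idm 1_))
    = eqm (esym (tensA Xb X (Xb \ox Y))) \oc (r \tx idm (Xb \ox Y)) \oc (idm 1_ \tx r').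
  rewrite tensmA_r -!compA eqmVK tensm_id; congr (_ \oc _).
  by rewrite -!tensm_comp !comp1m !compm1.
have : (idm Xb \tx M) \oc (eqm (esym (tensA Xb X 1_)) \oc (r \tx idm 1_)) = 0.
  by rewrite M0 tensm0 comp0m.
rewrite /M !splitl -!compA E -(tensm_id Xb Y) (tensmA_r r) tensmA_r.
rewrite (tensm_eqm erefl) -!compA.
rewrite (compA (eqm (esym (tensA Xb X _)))) eqm_comp.
rewrite (compA (eqm (f_equal2 _ _ _))) eqm_comp.
rewrite (compA (eqm (tensA Xb _ Y))) eqm_comp.
set e := etrans _ (tensA _ _ Y).
have -> : eqm e = eqm (esym (tensA Xb X Xb)) \tx idm Y.
  by rewrite (tensm_eqm _ erefl); exact: eqm_irr.
rewrite (compA (_ \tx idm Y) (_ \tx idm Y)) -splitr.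
rewrite (compA (_ \tx idm Y) (_ \tx idm Y)) -splitr -(compA (_ \tx dag rb)) r2 (tensm_eqm _ erefl).
move=> /eqm_eq0/eqm_eq0/eqm_eq0 r'0.
have := tens1m r'; rewrite r'0 compm0 => /esym/(congr1 (fun f => f \oc eqm (esym (tens1o _)))).
by rewrite comp0m -compA eqm_comp eqm_id compm1.
Qed.

Lemma Irr_unit : Irr C (iso_class 1_).
Proof. by exists 1_ => //; exact: simple_unit. Qed.

Definition Irr0 : Irr C := SigSub (mem_set Irr_unit).

End TensorCategory.

(* The choices made for Irr(C): representatives X_k with X_0 = id, the class
   kbar of the conjugate of X_k, whose conjugate object is X_kbar, standard
   solutions R_k and Rbar_k, and orthonormal bases of the spaces Mor(X_k, W). *)
Record irr_data (R : realType) (C : strictTensorCat R) := IrrData {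
  irep : Irr C -> C;
  irepP : forall k, val k (irep k);
  irep0 : irep (Irr0 C) = unit_ob C;
  ibar : Irr C -> Irr C;
  isol : forall k, Mor (unit_ob C) (irep (ibar k) \ox irep k);
  isolb : forall k, Mor (unit_ob C) (irep k \ox irep (ibar k));
  isolP : forall k, standard_solution_simple (isol k) (isolb k);
  ionb : forall k W, seq (Mor (irep k) W);
  ionbP : forall k W, onb (ionb k W)
}.

Section Algebras.
Variables (R : realType) (C : strictTensorCat R) (D : irr_data C).
Implicit Types k l m : Irr C.
Local Notation "1_" := (unit_ob C).
Local Notation X := (irep D).
Local Notation bar := (ibar D).

Lemma simple_irep k : simple (X k).
Proof.
have := irepP D k; have := set_mem (valP k); rewrite /Irr /= => -[Y sY ->] YX.
exact: simple_iso sY YX.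
Qed.

Lemma irep_iso k l : iso (X k) (X l) -> k = l.
Proof.
have classE m : val m = iso_class (X m).
  have := irepP D m; have := set_mem (valP m); rewrite /Irr /= => -[Y sY ->] YX.
  exact: iso_class_eq YX.
by move=> kl; apply: val_inj; rewrite !classE; exact: iso_class_eq.
Qed.

Lemma finite_irr_mor (W : C) : finite_set [set k | exists f : Mor (X k) W, f != 0].
Proof.
apply: contrapT => /infiniteP/card_leP/unsquash f.
pose p (a : nat) : Irr C := val (f (SigSub (mem_set (I : [set: nat] a)))).
set N := \dim (fullv : {vspace (Mor W W)}).
have hf (a : 'I_N.+1) : {f : Mor (X (p a)) W | f != 0}.
  by apply: cid; exact: (set_mem (valP (f (SigSub (mem_set (I : [set: nat] a)))))).
have := @simple_family_uniq_size _ _ N.+1 _ W (fun a => sval (hf a))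
  (fun a => simple_irep (p a)) (fun a => svalP (hf a)).
rewrite ltnn => H; suff: false by []; apply: H => a b /irep_iso ab.
apply: val_inj; have /val_inj/inj := ab.
by rewrite !inE => /(_ I I) [].
Qed.


Lemma ibar_inj : injective bar.
Proof.
move=> k l kl; have [solk _] := isolP D k.
have : exists (r' : Mor 1_ (X (bar k) \ox X l)) (rb' : Mor 1_ (X l \ox X (bar k))),
    conjugate_eqs r' rb'.
  by rewrite kl; exists (isol D l), (isolb D l); have [] := isolP D l.
move=> [r' [rb' soll]].
have M0 := conjugate_mor_neq0 solk soll (simple_irep l).1.
set M := (X in X != 0) in M0.
apply: irep_iso.
apply: (schur (f := eqm (tens1o (X l)) \oc (M \oc eqm (esym (tenso1 (X k)))))).
- exact: simple_irep.
- exact: simple_irep.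
- apply: contra_neq M0 => /eqm_eq0 M0.
  by rewrite -[M]compm1 -(eqm_id (etrans (tenso1 (X k)) (esym (tenso1 (X k)))))
    -eqm_comp compA M0 comp0m.
Qed.

(* The fusion algebra C[Irr(C)]: finitely supported functions on Irr(C), with
   the class [X_k] as [fusion_basis k]. *)
Definition fusion : Type := dirsum (fun _ : Irr C => R[i]^o).

HB.instance Definition _ := GRing.Lmodule.on fusion.

Definition fusion_basis k : fusion := ds_in k (1 : R[i]^o).

(* N^Z_{XY}, the multiplicity of X_n in X_m (x) X_l. *)
Definition fusion_coef m l n : nat := multiplicity (X n) (X m \ox X l).

(* The bilinear extension of [X_m][X_l] = \sum_n N^n_{ml} [X_n] and the
   conjugate-linear extension of [X_m]^* = [X_mbar]. *)
Definition fusion_mul (a b : fusion) : fusion :=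
  \sum_(m \in [set: Irr C]) \sum_(l \in [set: Irr C])
    (a m * b l) *: (\sum_(n \in [set: Irr C]) (fusion_coef m l n)%:R *: fusion_basis n).

Definition fusion_star (a : fusion) : fusion :=
  \sum_(m \in [set: Irr C]) (a m)^* *: fusion_basis (bar m).

End Algebras.

Arguments fusion {R} C.
Arguments fusion_basis {R C} k.

Record weight_set (R : realType) (C : strictTensorCat R) := WeightSet {
  wset :> set (set C);
  wset_sub : wset `<=` Obj_classes C;
  wrep : wset -> C;
  wrepP : forall i, val i (wrep i)
}.

Section Annular.
Variables (R : realType) (C : strictTensorCat R) (D : irr_data C).
Variable (L : weight_set C).
Implicit Types (k l m : Irr C) (i j s : L).
Local Notation "1_" := (unit_ob C).
Local Notation X := (irep D).
Local Notation Y := (wrep (w := L)).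
Local Notation bar := (ibar D).

(* The index (i, j, k) stands for the summand with subscripts i, j and
   superscript k, whose elements go from X_k (x) Y_i to Y_j (x) X_k. *)
Definition annular_summand (t : L * L * Irr C) : lmodType R[i] :=
  let: (i, j, k) := t in Mor (X k \ox Y i) (Y j \ox X k).

Definition annular : Type := dirsum annular_summand.

HB.instance Definition _ := GRing.Lmodule.on annular.

Definition annular_coef (x : annular) i j k : Mor (X k \ox Y i) (Y j \ox X k) :=
  x (i, j, k).

Definition annular_in i j k (f : Mor (X k \ox Y i) (Y j \ox X k)) : annular :=
  ds_in (V := annular_summand) (i, j, k) f.

(* The subspace of the i, j-corner, the sum over k of the summands i, j, k. *)
Definition annular_corner i j : set annular :=
  [set x | forall i' j' k, annular_coef x i' j' k != 0 -> i' = i /\ j' = j].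

Definition annular_mul_coef (x y : annular) i j k : Mor (X k \ox Y i) (Y j \ox X k) :=
  \sum_(s \in [set: L]) \sum_(m \in [set: Irr C]) \sum_(l \in [set: Irr C])
  \sum_(V <- ionb D k (X m \ox X l))
    (idm (Y j) \tx dag V)
    \oc eqm (esym (tensA (Y j) (X m) (X l)))
    \oc (annular_coef x s j m \tx idm (X l))
    \oc eqm (tensA (X m) (Y s) (X l))
    \oc (idm (X m) \tx annular_coef y i s l)
    \oc eqm (esym (tensA (X m) (X l) (Y i)))
    \oc (V \tx idm (Y i)).

Lemma tensA_mid (A B B' A' : C) : (A \ox (B \ox B')) \ox A' = (A \ox B) \ox (B' \ox A').
Proof. by rewrite !tensA. Qed.

Definition annular_star_coef (x : annular) i j k : Mor (X k \ox Y i) (Y j \ox X k) :=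
  eqm (tens1o (Y j \ox X k))
  \oc (dag (isolb D k) \tx (idm (Y j) \tx idm (X k)))
  \oc eqm (tensA_mid (X k) (X (bar k)) (Y j) (X k))
  \oc ((idm (X k) \tx dag (annular_coef x j i (bar k))) \tx idm (X k))
  \oc eqm (esym (tensA_mid (X k) (Y i) (X (bar k)) (X k)))
  \oc ((idm (X k) \tx idm (Y i)) \tx isol D k)
  \oc eqm (esym (tenso1 (X k \ox Y i))).

Lemma annular_mul_subproof (x y : annular) :
  finite_set [set t : L * L * Irr C |
    (let: (i, j, k) := t return annular_summand t in annular_mul_coef x y i j k) != 0].
Proof.
pose F (pq : (L * L * Irr C) * (L * L * Irr C)) : set (L * L * Irr C) :=
  (fun k => (pq.2.1.1, pq.1.1.2, k)) @`
    [set k | exists f : Mor (X k) (X pq.1.2 \ox X pq.2.2), f != 0].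
apply: (@sub_finite_set _ _
  (\bigcup_(pq in [set t | x t != 0] `*` [set t | y t != 0]) F pq)); last first.
  apply: bigcup_finite; first by apply: finite_setX; exact: ds_finite.
  by move=> pq _; apply: finite_image; exact: finite_irr_mor.
move=> [[i j] k] /= xy0; apply: contrapT => no; move/eqP: xy0; apply.
rewrite /annular_mul_coef; apply: fsbig1 => s _; apply: fsbig1 => m _.
apply: fsbig1 => l _; apply: big1_seq => V _.
have [x0|x0] := eqVneq (annular_coef x s j m) 0.
  by rewrite x0 tens0m compm0 !comp0m.
have [y0|y0] := eqVneq (annular_coef y i s l) 0.
  by rewrite y0 tensm0 compm0 !comp0m.
have [->|V0] := eqVneq V 0; first by rewrite tens0m compm0.
case: no; exists ((s, j, m), (i, s, l)) => //=.
by exists k => //=; exists V.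
Qed.

Lemma annular_star_subproof (x : annular) :
  finite_set [set t : L * L * Irr C |
    (let: (i, j, k) := t return annular_summand t in annular_star_coef x i j k) != 0].
Proof.
pose h (t : L * L * Irr C) := (t.1.2, t.1.1, bar t.2).
have h_inj : injective h.
  by move=> [[i j] k] [[i' j'] k'] [-> -> /ibar_inj ->].
apply: (@sub_finite_set _ _ (h @^-1` [set t | x t != 0])).
  move=> [[i j] k] /=; apply: contra_neq => x0.
  have {}x0 : annular_coef x j i (bar k) = 0 by exact: x0.
  by rewrite /annular_star_coef x0 dag0 tensm0 tens0m compm0 !comp0m.
by apply: finite_preimage (ds_finite x) => t t' _ _ /h_inj.
Qed.

Definition annular_mul (x y : annular) : annular := DirSum (annular_mul_subproof x y).

Definition annular_star (x : annular) : annular := DirSum (annular_star_subproof x).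

End Annular.

Arguments annular {R C} D L.
Arguments annular_in {R C} D {L} i j k f.
Arguments annular_corner {R C} D {L} i j.
Arguments annular_mul {R C D L} x y.
Arguments annular_star {R C D L} x.

(* Main.v *)
Require Import Defs.
From HB Require Import structures.
From mathcomp Require Import all_boot all_order all_algebra.
From mathcomp Require Import complex.
From mathcomp Require Import boolp classical_sets functions cardinality fsbigop.
From mathcomp Require Import reals.

(* Since Y_0 = id, each space Mor(X_k (x) Y_0, Y_0 (x) X_k) is End(X_k), a line
   spanned by 1_{X_k}; so [X_k] |-> 1_{X_k} is a linear bijection onto the
   corner.  In a product 1_{X_m} . 1_{X_l}, each V in onb(X_k, X_m (x) X_l)
   contributes V^* V = 1_{X_k}, whence the coefficient
   dim Mor(X_k, X_m (x) X_l) = N^k_{ml}.  The involution of 1_{X_kbar} is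
   1_{X_k} by the conjugate equations; it matches [X_k]^* because k |-> kbar is
   involutive, conjugates being unique up to isomorphism. *)

Set Implicit Arguments.
Unset Strict Implicit.
Unset Printing Implicit Defensive.

Import Order.TTheory GRing.Theory Num.Theory.

Local Open Scope classical_set_scope.
Local Open Scope ring_scope.

(** * Sums with finite support *)

Section FiniteSupportSums.
Variables (I : choiceType) (V W : nmodType).

(** A sum over an infinite support defaults to 0, so additivity alone does not suffice. The finite
    set [A] contains the support of [F], hence also that of [f] applied to [F], which may be
    smaller. *)
Lemma raddf_fsbig (f : V -> W) (A : set I) (F : I -> V) :
    f 0 = 0 -> {morph f : x y / x + y} -> finite_set A ->
    (forall t, ~ A t -> F t = 0) ->
  f (\sum_(t \in [set: I]) F t) = \sum_(t \in [set: I]) f (F t).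
Proof.
move=> f0 fD finA F0.
rewrite -(fsbig_widen A) // => [|t [_ /F0]//].
rewrite -[RHS](fsbig_widen A) // => [|t [_ /F0 /= ->]//].
by rewrite !fsbig_finite// (big_morph f fD f0).
Qed.

Lemma fsbig_only1 (t0 : I) (F : I -> V) :
  (forall t, t <> t0 -> F t = 0) -> \sum_(t \in [set: I]) F t = F t0.
Proof.
by move=> F0; rewrite -(fsbig_widen [set t0]) ?fsbig_set1// => t [_ /F0].
Qed.

End FiniteSupportSums.

Lemma ds_inE (K : pzRingType) (I : choiceType) (V : I -> lmodType K) t (u : V t) :
  ds_in t u t = u.
Proof.
by rewrite /= /ds_in_fun; case: eqP => // e; rewrite (Prop_irrelevance e erefl).
Qed.

Lemma ds_in_neq (K : pzRingType) (I : choiceType) (V : I -> lmodType K) t t' (u : V t) :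
  t <> t' -> ds_in t u t' = 0.
Proof. by rewrite /= /ds_in_fun; case: eqP. Qed.

Section CStarCategories.
Local Open Scope complex_scope.
Local Open Scope cat_scope.
Variables (R : realType) (C : cstarCat R).
Implicit Types X Y Z W : C.

Lemma dagZ X Y (a : R[i]) (f : Mor X Y) : dag (a *: f) = a^* *: dag f.
Proof. by have := dag_antilin a f 0; rewrite dag0 !addr0. Qed.

(** Semisimplicity supplies a decomposition of [W], so [xget] does not fall back on its default
    0. *)
Lemma multiplicity_dim X W : semisimple C -> simple X ->
  multiplicity X W = \dim (fullv : {vspace (Mor X W)}).
Proof.
move=> /(_ W)[n [S [v [dv sS]]]] sX; apply: is_multiplicity_dim => //.
by apply: xgetPex; exists #|[set a | `[< iso X (S a) >]]%SET|, n, S, v.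
Qed.

End CStarCategories.

(** * Tensoring with the unit object, and uniqueness of conjugates *)

Section TensorCategories.
(* [all_boot] shadows the associativity lemma [compA] of the category. *)
Import Defs.
Local Open Scope complex_scope.
Local Open Scope cat_scope.
Variables (R : realType) (C : strictTensorCat R).
Local Notation "1_" := (unit_ob C).
Implicit Types X Y Z W A B : C.

Lemma eqm_compr X Y Z W (e : X = Y) (e' : Y = Z) (f : Mor W X) :
  eqm e' \oc (eqm e \oc f) = eqm (etrans e e') \oc f.
Proof. by rewrite compA eqm_comp. Qed.

Lemma eqm_neq0 X Y (e : X = Y) : idm X != 0 -> eqm e != 0.
Proof. by subst Y. Qed.

Lemma tensZm X X' Y Y' (a : R[i]) (f : Mor X X') (g : Mor Y Y') :
  (a *: f) \tx g = a *: (f \tx g).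
Proof. by have := tensm_linl a f 0 g; rewrite tens0m !addr0. Qed.

Lemma tensmZ X X' Y Y' (a : R[i]) (f : Mor X X') (g : Mor Y Y') :
  f \tx (a *: g) = a *: (f \tx g).
Proof. by have := tensm_linr f a g 0; rewrite tensm0 !addr0. Qed.

(** [A] occurs in the type of the morphism, so replacing it by [B] costs an identity morphism at
    each end. The intended use is [e := tens1o A]. *)
Lemma tensm_idm_transport X Y A B (e : A = B) (f : Mor X Y) :
  f \tx idm A = eqm (f_equal2 tens (erefl Y) (esym e)) \oc (f \tx idm B)
                  \oc eqm (f_equal2 tens (erefl X) e).
Proof. by subst B; rewrite !eqm_id comp1m compm1. Qed.

Lemma idm_tensm_transport X Y A B (e : A = B) (f : Mor X Y) :
  idm A \tx f = eqm (f_equal2 tens (esym e) (erefl Y)) \oc (idm B \tx f)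
                  \oc eqm (f_equal2 tens e (erefl X)).
Proof. by subst B; rewrite !eqm_id comp1m compm1. Qed.

(** Tensoring with the unit on either side gives back [g], by [tens1m] and [tensm1]. The equalities
    [eA] and [eB] may be arbitrary, since [eqm] does not depend on the proof. *)
Lemma eqm_unit_natural A B Y (Y1 : Y = 1_) (g : Mor A B)
    (eA : A \ox Y = Y \ox A) (eB : B \ox Y = Y \ox B) :
  (idm Y \tx g) \oc eqm eA = eqm eB \oc (g \tx idm Y).
Proof.
subst Y; have := congr1 (fun f => eqm (esym (tens1o B)) \oc f) (tens1m g).
have := congr1 (fun f => eqm (esym (tenso1 B)) \oc f) (tensm1 g).
rewrite !eqmK => -> ->.
rewrite -!compA eqm_comp eqm_compr.
by rewrite (eqm_irr (etrans eA _) (tenso1 A)) (eqm_irr (etrans _ eB) (esym (tens1o B))).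
Qed.

(** This is the term of [V] in the product of two identities. The inner factors merge into one
    [eqm]; naturality carries it past [dag V], which then meets [V]. *)
Lemma unit_mul_term A B X Y (Y1 : Y = 1_) (V : Mor X (A \ox B))
    (eA : A \ox Y = Y \ox A) (eB : B \ox Y = Y \ox B) (eX : X \ox Y = Y \ox X) :
  dag V \oc V = idm X ->
  (idm Y \tx dag V) \oc eqm (esym (tensA Y A B)) \oc (eqm eA \tx idm B)
    \oc eqm (tensA A Y B) \oc (idm A \tx eqm eB)
    \oc eqm (esym (tensA A B Y)) \oc (V \tx idm Y) = eqm eX.
Proof.
move=> VV; rewrite (tensm_eqm eA (erefl B)) (tensm_eqm (erefl A) eB) -!compA !eqm_compr compA.
by rewrite (eqm_unit_natural Y1 _ _ eX) -compA -tensm_comp VV comp1m tensm_id compm1.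
Qed.

Lemma unit_star_term A Ab Y (Y1 : Y = 1_) (r : Mor 1_ (Ab \ox A)) (rb : Mor 1_ (A \ox Ab))
    (eb : Y \ox Ab = Ab \ox Y) (e : A \ox Y = Y \ox A) :
  conjugate_eqs r rb ->
  eqm (tens1o (Y \ox A))
  \oc (dag rb \tx (idm Y \tx idm A))
  \oc eqm (tensA_mid A Ab Y A)
  \oc ((idm A \tx eqm eb) \tx idm A)
  \oc eqm (esym (tensA_mid A Y Ab A))
  \oc ((idm A \tx idm Y) \tx r)
  \oc eqm (esym (tenso1 (A \ox Y))) = eqm e.
Proof.
move=> [r1 _]; subst Y.
rewrite -!compA (compA (_ \tx _)) (compA _ (idm A \tx r)) in r1.
rewrite !tensm_id (tensm_idm_transport (tens1o A)) (idm_tensm_transport (tenso1 A)).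
rewrite (tensm_eqm (erefl A) eb) (tensm_eqm _ (erefl A)) -!compA !eqm_compr eqm_comp.
set e1 := etrans _ _; set e2 := etrans _ _; set e3 := etrans _ _.
rewrite (eqm_irr e2 (tensA A Ab A)) (compA (_ \tx _)) (compA _ (idm A \tx r)).
(* What remains between the [eqm] factors is the left side of the first conjugate equation, so it is
   itself an [eqm]. *)
by rewrite (eqm_move r1) !eqm_comp; exact: eqm_irr.
Qed.

Lemma conjugate_eqs_sym X Xb (r : Mor 1_ (Xb \ox X)) (rb : Mor 1_ (X \ox Xb)) :
  conjugate_eqs r rb -> conjugate_eqs rb r.
Proof. by case. Qed.

(** The morphism of [conjugate_mor_neq0] becomes, up to [eqm], a nonzero map from [X] to [Y], and
    Schur's lemma applies. *)
Lemma conjugate_iso X Y Xb (r : Mor 1_ (Xb \ox X)) (rb : Mor 1_ (X \ox Xb))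
    (r' : Mor 1_ (Xb \ox Y)) (rb' : Mor 1_ (Y \ox Xb)) :
    simple X -> simple Y -> conjugate_eqs r rb -> conjugate_eqs r' rb' -> iso X Y.
Proof.
move=> sX sY sol sol'; have := conjugate_mor_neq0 sol sol' sY.1.
set M := (X in X != 0) => M0.
apply: (schur (f := eqm (tens1o Y) \oc (M \oc eqm (esym (tenso1 X))))) => //.
apply: contra_neq M0 => /eqm_eq0 M0.
by rewrite -[M]compm1 -(eqm_id (etrans (tenso1 X) (esym (tenso1 X)))) -eqm_comp compA M0 comp0m.
Qed.

(** Exchanging the two solutions chosen for [ibar D k] makes the representative of [ibar D k] a
    conjugate of that of [ibar D (ibar D k)]; it is also a conjugate of that of [k]. *)
Lemma ibarK (D : irr_data C) : involutive (ibar D).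
Proof.
move=> k; apply: (@irep_iso _ _ D).
have [/conjugate_eqs_sym sol' _] := isolP D (ibar D k).
have [sol _] := isolP D k.
exact: conjugate_iso (simple_irep D _) (simple_irep D _) sol' sol.
Qed.

End TensorCategories.

(** * The linear bijection onto the corner *)

Section CornerMap.
Local Open Scope complex_scope.
Local Open Scope cat_scope.
Variables (R : realType) (C : strictTensorCat R) (D : irr_data C) (L : weight_set C).
Variables (i0 : L) (Y0 : wrep i0 = unit_ob C).
Implicit Types (a b : fusion C) (k l m n : Irr C) (t : L * L * Irr C).
Local Notation X := (irep D).
Local Notation Y := (wrep (w := L)).

Local Notation u k := (eqm (tens_unitC (X k) Y0)).
Local Notation e0 k := (annular_in D i0 i0 k (u k)).

(** Evaluating [e0 t.2] at [t] yields 0 off the corner and has the right dependent type for every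
    [t], with no case analysis on equality of weights. *)
Definition corner_coef a t : annular_summand D t := a t.2 *: e0 t.2 t.

Lemma corner_coef_finite a : finite_set [set t | corner_coef a t != 0].
Proof.
apply: (@sub_finite_set _ _ ((fun k => (i0, i0, k)) @` [set k | a k != 0])).
  move=> t /=; rewrite /corner_coef => at0; exists t.2.
    by apply: contra_neq at0 => ->; rewrite scale0r.
  by apply: contraPP at0 => ne; rewrite [X in _ *: X]ds_in_neq ?scaler0 ?eqxx.
by apply: finite_image; exact: ds_finite.
Qed.

Definition corner_map a : annular D L := DirSum (corner_coef_finite a).

Lemma corner_map_linear : linear corner_map.
Proof.
move=> c a b; apply: dirsum_ext => t /=; rewrite /corner_coef /=.
by rewrite scalerDl scalerA.
Qed.

HB.instance Definition _ := GRing.isLinear.Build R[i] (fusion C) (annular D L) *:%R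
  corner_map corner_map_linear.

Lemma corner_map_diag a k : corner_map a (i0, i0, k) = a k *: u k.
Proof. by rewrite /= /corner_coef [X in _ *: X]ds_inE. Qed.

Lemma corner_map_off a i j k : ~ (i = i0 /\ j = i0) -> corner_map a (i, j, k) = 0.
Proof.
move=> ij; rewrite /= /corner_coef [X in _ *: X]ds_in_neq ?scaler0//.
by move=> [ii jj]; apply: ij.
Qed.

Lemma corner_map_basis k : corner_map (fusion_basis k) = e0 k.
Proof.
apply: dirsum_ext => t; have [<-|kt] := eqVneq (i0, i0, k) t.
  by rewrite corner_map_diag [X in X *: _]ds_inE scale1r [RHS]ds_inE.
rewrite [RHS]ds_in_neq; last exact/eqP.
case: t kt => [[i j] l] kt.
have [[ii jj]|] := pselect (i = i0 /\ j = i0); last exact: corner_map_off.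
subst i j; rewrite corner_map_diag [X in X *: _]ds_in_neq ?scale0r// => kl.
by rewrite kl eqxx in kt.
Qed.

Lemma u_neq0 k : u k != 0.
Proof. by apply: eqm_neq0; rewrite Y0 tenso1; exact: (simple_irep D k).1. Qed.

Lemma corner_map_inj : injective corner_map.
Proof.
move=> a b ab; apply: dirsum_ext => k.
have : corner_map a (i0, i0, k) = corner_map b (i0, i0, k) by rewrite ab.
rewrite !corner_map_diag => /eqP; rewrite -subr_eq0 -scalerBl scaler_eq0 (negbTE (u_neq0 k)).
by rewrite orbF subr_eq0 => /eqP.
Qed.

Lemma unit_summand_line k (f : Mor (X k \ox Y i0) (Y i0 \ox X k)) :
  exists c : R[i], f = c *: u k.
Proof.
have s : simple (X k \ox Y i0) by rewrite Y0 tenso1; exact: simple_irep.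
have [c fc] := s.2 (eqm (esym (tens_unitC (X k) Y0)) \oc f); exists c.
by rewrite -[f](eqmVK (tens_unitC (X k) Y0)) fc compZr compm1.
Qed.

Lemma range_corner_map : range corner_map = annular_corner D i0 i0.
Proof.
apply/seteqP; split=> [_ [a _ <-] i j k ak|x xc].
  by apply: contrapT => /(corner_map_off a k) ak0; rewrite /annular_coef ak0 eqxx in ak.
have /choice [c xcE] : forall k, exists c : R[i], x (i0, i0, k) = c *: u k.
  by move=> k; exact: unit_summand_line.
(* As [u k] is nonzero, [k |-> (i0, i0, k)] maps the support of [c] injectively into that of [x]. *)
have cfin : finite_set [set k | (c k : R[i]^o) != 0].
  apply: (@sub_finite_set _ _ ((fun k => (i0, i0, k)) @^-1` [set t | x t != 0])).
    by move=> k /= ck; rewrite xcE scaler_eq0 negb_or ck u_neq0.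
  by apply: finite_preimage (ds_finite x) => k l _ _ [].
exists (DirSum cfin) => //; apply: dirsum_ext => -[[i j] k].
have [[ii jj]|nij] := pselect (i = i0 /\ j = i0).
  by subst i j; rewrite corner_map_diag /= xcE.
rewrite corner_map_off//; apply/esym/eqP; apply: contrapT => /negP xt.
by apply: nij; apply: xc xt.
Qed.

(** * Compatibility with products *)

Hypothesis C_semisimple : semisimple C.

Lemma size_ionb m l n : size (ionb D n (X m \ox X l)) = fusion_coef D m l n.
Proof.
rewrite /fusion_coef multiplicity_dim//; last exact: simple_irep.
by have [bs _] := ionbP D n (X m \ox X l); rewrite (size_basis (X := in_tuple _) bs).
Qed.

Lemma fusion_coef_finite m l : finite_set [set n | fusion_coef D m l n != 0%N].
Proof.
apply: sub_finite_set (finite_irr_mor D (X m \ox X l)) => n /=.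
rewrite /fusion_coef multiplicity_dim//; last exact: simple_irep.
(* A nonzero space has the nonzero vector [vpick], which witnesses membership in the finite set of
   [finite_irr_mor]. *)
by rewrite dimv_eq0 -vpick0 => f0; eexists; exact: f0.
Qed.

Lemma fusion_basisE k n : (fusion_basis k : fusion C) n = (k == n)%:R.
Proof.
by have [<-|/eqP kn] := eqVneq k n; [rewrite [LHS]ds_inE|rewrite [LHS]ds_in_neq].
Qed.

Lemma fusion_mulE a b n : fusion_mul D a b n =
  \sum_(m \in [set: Irr C]) \sum_(l \in [set: Irr C])
    (a m * b l) * (fusion_coef D m l n)%:R.
Proof.
(* Evaluation at [n] passes through the three nested sums, whose supports are bounded by those of
   [a], of [b] and of the fusion coefficients. *)
pose ev (x : fusion C) : R[i] := x n.
have ev0 : ev 0 = 0 by [].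
have evD : {morph ev : x y / x + y} by [].
have N0 m l x : [set n | fusion_coef D m l n != 0%N] x \/
    (fusion_coef D m l x)%:R *: (fusion_basis x : fusion C) = 0.
  by have [->|] := eqVneq (fusion_coef D m l x) 0%N; [right; rewrite scale0r|left].
rewrite -/(ev _) (raddf_fsbig ev0 evD (ds_finite a)); last first.
  move=> m /= /negP; rewrite negbK => /eqP am; apply: fsbig1 => l _.
  by rewrite am mul0r scale0r.
apply: eq_fsbigr => m _.
rewrite (raddf_fsbig ev0 evD (ds_finite b)); last first.
  by move=> l /= /negP; rewrite negbK => /eqP ->; rewrite mulr0 scale0r.
apply: eq_fsbigr => l _; rewrite /ev /= -/(ev _); congr (_ * _).
rewrite (raddf_fsbig ev0 evD (fusion_coef_finite m l)); last by move=> x; case: (N0 m l x).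
rewrite (fsbig_only1 (t0 := n)) /ev /= => [|x xn].
  by rewrite [X in _ *: X](fusion_basisE n n) eqxx [LHS]mulr1.
by rewrite [X in _ *: X](fusion_basisE x n) (negbTE (introN eqP xn)) scaler0.
Qed.

Lemma corner_map_mul_coef_off a b i j k : ~ (i = i0 /\ j = i0) ->
  annular_mul_coef (corner_map a) (corner_map b) i j k = 0.
Proof.
move=> ij; apply: fsbig1 => s _; apply: fsbig1 => m _; apply: fsbig1 => l _.
(* The left factor carries the target weight [j] and the right one the source weight [i], so one of
   them lies off the corner. *)
apply: big1_seq => V _; rewrite /annular_coef; have [jj|nj] := pselect (j = i0).
  rewrite (corner_map_off b l (i := i)); last by move=> [ii _]; apply: ij.
  by rewrite tensm0 compm0 !comp0m.
rewrite (corner_map_off a m (j := j)); last by case.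
by rewrite tens0m compm0 !comp0m.
Qed.

Lemma corner_map_mul_coef_diag a b k :
  annular_mul_coef (corner_map a) (corner_map b) i0 i0 k = fusion_mul D a b k *: u k.
Proof.
rewrite /annular_mul_coef (fsbig_only1 (t0 := i0)) => [|s si]; last first.
  apply: fsbig1 => m _; apply: fsbig1 => l _; apply: big1_seq => V _.
  rewrite /annular_coef (corner_map_off a m); last by case.
  by rewrite tens0m compm0 !comp0m.
pose scl (c : R[i]) := c *: u k.
have scl0 : scl 0 = 0 by rewrite /scl scale0r.
have sclD : {morph scl : x y / x + y} by move=> x y; rewrite /scl scalerDl.
rewrite fusion_mulE -/(scl _) (raddf_fsbig scl0 sclD (ds_finite a)); last first.
  move=> m /= /negP; rewrite negbK => /eqP am; apply: fsbig1 => l _.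
  by rewrite am !mul0r.
apply: eq_fsbigr => m _.
rewrite (raddf_fsbig scl0 sclD (ds_finite b)); last first.
  by move=> l /= /negP; rewrite negbK => /eqP ->; rewrite mulr0 mul0r.
apply: eq_fsbigr => l _; rewrite /annular_coef !corner_map_diag.
set s := ionb D k _.
(* Every [V] contributes the same vector, so the sum only counts the orthonormal basis. *)
rewrite (eq_big_seq (fun=> (a m * b l) *: u k)) => [|V Vs].
  rewrite big_const_seq count_predT iter_addr_0 -/s size_ionb /scl.
  by rewrite mulr_natr scalerMnl.
have VV : dag V \oc V = idm (X k).
  have [_ /(_ (index V s) (index V s))] := ionbP D k (X m \ox X l).
  by rewrite !index_mem !nth_index// eqxx scale1r; apply.
rewrite tensmZ tensZm !(compZl, compZr) scalerA.
by rewrite (unit_mul_term Y0 _ _ (tens_unitC (X k) Y0) VV) mulrC.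
Qed.

Lemma corner_map_mul a b :
  corner_map (fusion_mul D a b) = annular_mul (corner_map a) (corner_map b).
Proof.
apply: dirsum_ext => -[[i j] k]; rewrite [RHS]/=.
have [[ii jj]|nij] := pselect (i = i0 /\ j = i0).
  by subst i j; rewrite corner_map_diag corner_map_mul_coef_diag.
by rewrite corner_map_off// corner_map_mul_coef_off.
Qed.

(** * Compatibility with the involutions *)

Lemma fusion_starE a n : fusion_star D a n = (a (ibar D n))^*.
Proof.
pose ev (x : fusion C) : R[i] := x n.
rewrite -[LHS]/(ev _) (raddf_fsbig (f := ev) _ _ (ds_finite a)) //; last first.
  by move=> m /= /negP; rewrite negbK => /eqP ->; rewrite rmorph0 scale0r.
(* Since [ibar] is involutive, [ibar D n] is the only index whose conjugate is [n]. *)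
rewrite (fsbig_only1 (t0 := ibar D n)) /ev /= => [|m mn].
  by rewrite [X in _ *: X]fusion_basisE ibarK eqxx [LHS]mulr1.
rewrite [X in _ *: X]fusion_basisE; case: eqP => [nm|]; last by rewrite scaler0.
by case: mn; rewrite -nm ibarK.
Qed.

Lemma corner_map_star a : corner_map (fusion_star D a) = annular_star (corner_map a).
Proof.
apply: dirsum_ext => -[[i j] k]; rewrite -[RHS]/(annular_star_coef _ _ _ _).
rewrite /annular_star_coef /annular_coef.
have [[ii jj]|nij] := pselect (i = i0 /\ j = i0); last first.
  (* The involution reads the coefficient with [i] and [j] exchanged, which is still off the
     corner. *)
  rewrite (corner_map_off a _ (i := j)); last by move=> [jj ii]; apply: nij.
  by rewrite corner_map_off// dag0 tensm0 tens0m compm0 !comp0m.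
subst i j; rewrite !corner_map_diag dagZ tensmZ tensZm !(compZl, compZr) eqm_dag.
have [sol _] := isolP D k.
by rewrite (unit_star_term Y0 _ (tens_unitC (X k) Y0) sol) fusion_starE.
Qed.

End CornerMap.

Theorem proposition3p1 (R : realType) (C : strictTensorCat R)
  (C_sums : has_direct_sums C) (C_subobjects : has_subobjects C)
  (C_semisimple : semisimple C) (C_rigid : rigid C)
  (C_countable : countable (Irr C))
  (D : irr_data C) (L : weight_set C)
  (L0 : iso_class (unit_ob C) \in (L : set (set C)))
  (Y0 : wrep (SigSub L0 : L) = unit_ob C) :
  let i0 : L := SigSub L0 in
  exists phi : {linear fusion C -> annular D L},
    [/\ forall k : Irr C, phi (fusion_basis k) =
          annular_in D i0 i0 k
            (eqm (tens_unitC (irep D k) Y0)),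
        injective phi,
        range phi = annular_corner D i0 i0,
        forall a b : fusion C,
          phi (fusion_mul D a b) = annular_mul (phi a) (phi b)
      & forall a : fusion C,
          phi (fusion_star D a) = annular_star (phi a)].
Proof.
exists (corner_map D Y0); split.
- exact: corner_map_basis.
- exact: corner_map_inj.
- exact: range_corner_map.
- exact: corner_map_mul.
- exact: corner_map_star.
Qed.
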